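(* Let $m,r\ge 0$ and $n,s\ge 1$ be integers with $m\le n$ and $r\le s$, and consider two Laurent polynomials $$p(z)=\sum_{k=-m}^{n} a_k z^k \quad\text{and}\quad \widetilde{p}(z)=\sum_{k=-r}^{s} b_k z^k$$ with complex coefficients such that $a_{-m}a_n b_{-r}b_s\neq 0$. Let $h,\widetilde{h}\in\mathbb{R}[x,y]$ be the polynomials associated with $p$ and $\widetilde{p}$, respectively, as defined in the context. Then the intersection $p(\mathbb{T})\cap\widetilde{p}(\mathbb{T})$ consists of at most $4ns-2(n-m)(s-r)$ points unless $h$ and $\widetilde{h}$ have a nontrivial (i.e. nonconstant) common factor.
   Context: $\mathbb{T}=\{z\in\mathbb{C}:|z|=1\}$ is the unit circle. Definition of the polynomial $h$ associated with a Laurent polynomial $p(z)=\sum_{k=-m}^n a_kz^k$, where $0\le m\le n$, $n\ge 1$, $a_{-m}a_n\ne 0$: put $$g(z)=z^m(p(z)-w),\qquad g^*(z)=z^{n+m}\,\overline{g(1/\overline{z})}=z^n\,\overline{(p(1/\overline{z})-w)}.$$ Both are regarded as polynomials in $z$ of formal degree $m+n$ whose coefficients lie in $\mathbb{C}[w,\overline{w}]$ ($w$ and $\overline{w}$ being treated as independent variables): the coefficients of $g$, listed from $z^0$ to $z^{m+n}$, are $a_{-m},\dots,a_0-w,\dots,a_n$, and those of $g^*$, listed from $z^0$ to $z^{m+n}$, are $\overline{a_n},\dots,\overline{a_0}-\overline{w},\dots,\overline{a_{-m}}$. Let $h_{\mathbb{C}}=\operatorname{res}(g,g^* )\in\mathbb{C}[w,\overline{w}]$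 be their resultant with respect to $z$, i.e. the determinant of their $2(m+n)\times 2(m+n)$ Sylvester matrix (first $m+n$ rows: shifts of the coefficient list of $g$; last $m+n$ rows: shifts of the coefficient list of $g^*$). Then $h(x,y):=h_{\mathbb{C}}(x+iy,x-iy)$, which is a polynomial with real coefficients. The polynomial $\widetilde{h}$ is defined in the same way from $\widetilde{p}$, with $m,n,a_k$ replaced by $r,s,b_k$. *)

(* Defs.v *)
From HB Require Import structures.
From mathcomp Require Import all_boot all_order all_algebra.
From mathcomp Require Import fingroup perm complex zify.
From mathcomp Require Import boolp classical_sets functions cardinality reals.

Set Implicit Arguments.
Unset Strict Implicit.
Unset Printing Implicit Defensive.

Import Order.TTheory GRing.Theory Num.Theory.

Local Open Scope ring_scope.
Local Open Scope classical_set_scope.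

(* The coefficient family of a Laurent polynomial is a function a : int -> R[i]
   of which only the values a k with -m <= k <= n matter. *)
Definition laurent (R : realType) (m n : nat) (a : int -> R[i]) (z : R[i]) :
    R[i] :=
  \sum_(i < (m + n).+1) a (i%:Z - m%:Z) * z ^ (i%:Z - m%:Z).

Definition unit_circle (R : realType) : set R[i] := [set z | `|z| = 1].

(* Elements of {poly {poly R[i]}} stand for elements of C[w, wbar], with
   w = 'X (outer variable) and wbar = 'Y (inner variable). *)
Definition gpoly (R : realType) (m n : nat) (a : int -> R[i]) :
    {poly {poly {poly R[i]}}} :=
  \poly_(i < (m + n).+1) (a (i%:Z - m%:Z))%:P%:P - 'X *: 'X^m.

Definition gstar (R : realType) (m n : nat) (a : int -> R[i]) :
    {poly {poly {poly R[i]}}} :=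
  \poly_(i < (m + n).+1) (conjc (a (n%:Z - i%:Z)))%:P%:P - 'Y *: 'X^n.

(* [resultant] uses the actual degrees in z.  When n >= 1 and a_{-m} a_n != 0
   these are the formal degree m + n, even if m = 0 (see [size_gpoly] and
   [size_gstar]), and hC is the Sylvester determinant of [hC_Sylvester]. *)
Definition hC (R : realType) (m n : nat) (a : int -> R[i]) :
    {poly {poly R[i]}} :=
  resultant (gpoly m n a) (gstar m n a).

Definition subst2 (K : comNzRingType) (u : {poly {poly K}})
    (s t : {poly {poly K}}) : {poly {poly K}} :=
  (map_poly (map_poly (polyC \o polyC)) u).[s, t].

Definition hsub (R : realType) (m n : nat) (a : int -> R[i]) :
    {poly {poly R[i]}} :=
  subst2 (hC m n a) ('X + 'i%C%:P%:P * 'Y) ('X - 'i%C%:P%:P * 'Y).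

(* R[x,y] is {poly {poly R}} with x = 'X (outer) and y = 'Y (inner).  Taking
   real parts of the coefficients loses nothing, by [hpolyE] below. *)
Definition hpoly (R : realType) (m n : nat) (a : int -> R[i]) :
    {poly {poly R}} :=
  map_poly (map_poly (@complex.Re R)) (hsub m n a).

(* Divisibility is spelled out because %| on {poly {poly R}} is
   pseudo-divisibility, which ignores nonzero factors from {poly R}. *)
Definition have_nonconstant_common_factor (K : comNzRingType)
    (u v : {poly {poly K}}) : Prop :=
  exists f : {poly {poly K}},
    [/\ forall c : K, f <> c%:P%:P,
        exists q, u = f * q
      & exists q, v = f * q].

Section Facts.
Variables (R : realType) (m n : nat) (a : int -> R[i]).

Lemma coef_gpoly k : (k <= m + n)%N ->
  (gpoly m n a)`_k = (a (k%:Z - m%:Z))%:P%:P - 'X *+ (k == m).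
Proof.
by move=> hk; rewrite coefB coef_poly ltnS hk coefZ coefXn mulr_natr.
Qed.

Lemma coef_gstar k : (k <= m + n)%N ->
  (gstar m n a)`_k = (conjc (a (n%:Z - k%:Z)))%:P%:P - 'Y *+ (k == n).
Proof.
by move=> hk; rewrite coefB coef_poly ltnS hk coefZ coefXn mulr_natr.
Qed.

Lemma size_gpoly : (1 <= n)%N -> a n%:Z != 0 ->
  size (gpoly m n a) = (m + n).+1.
Proof.
move=> n0 an0; apply/eqP; rewrite eqn_leq; apply/andP; split.
  apply: (leq_trans (size_polyD _ _)); rewrite size_polyN geq_max size_poly /=.
  by apply: (leq_trans (size_scale_leq _ _)); rewrite size_polyXn ltnS leq_addr.
rewrite ltnNge; apply/negP => /leq_sizeP/(_ _ (leqnn _)); rewrite coef_gpoly //.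
have -> : (m + n == m)%N = false by rewrite -{2}[m]addn0 eqn_add2l; case: n n0.
have -> : (m + n)%N%:Z - m%:Z = n%:Z by rewrite PoszD addrC addKr.
rewrite mulr0n subr0 => /eqP.
by rewrite !polyC_eq0 (negPf an0).
Qed.

Lemma size_gstar : (1 <= n)%N -> a (- m%:Z) != 0 ->
  size (gstar m n a) = (m + n).+1.
Proof.
move=> n0 am0; apply/eqP; rewrite eqn_leq; apply/andP; split.
  apply: (leq_trans (size_polyD _ _)); rewrite size_polyN geq_max size_poly /=.
  by apply: (leq_trans (size_scale_leq _ _)); rewrite size_polyXn ltnS leq_addl.
rewrite ltnNge; apply/negP => /leq_sizeP/(_ _ (leqnn _)); rewrite coef_gstar //.
have -> : n%:Z - (m + n)%N%:Z = - m%:Z by rewrite PoszD opprD addrCA subrr addr0.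
move/eqP.
have -> : (m + n == n)%N = (m == 0)%N by rewrite -{2}[n]add0n eqn_add2r.
move: am0; case: (m == 0)%N => am0; last by rewrite mulr0n subr0 !polyC_eq0 conjc_eq0 (negPf am0).
rewrite subr_eq0 => /eqP/polyC_inj E; have := congr1 (fun q => size (polyseq q)) E.
by rewrite size_polyX => E2; have := size_polyC_leq1 (conjc (a (- m%:Z))); rewrite E2.
Qed.

End Facts.

(* Explicit Sylvester determinant: N shifts of p followed by N shifts of q, the
   coefficients being listed from degree 0 to degree N. *)
Lemma resultantE (A : nzRingType) (N : nat) (p q : {poly A}) :
  size p = N.+1 -> size q = N.+1 ->
  resultant p q = \det (\matrix_(i < N + N, j < N + N)
    (if (i < N)%N then p`_(j - i) *+ (i <= j)%N
     else q`_(j - (i - N)) *+ (i - N <= j)%N)).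
Proof.
move=> sp sq; rewrite /resultant.
have E (dp dq : nat) (S : 'M[A]_(dq + dp)) : dp = N -> dq = N ->
    (forall i j, S i j = match fintype.split i with
       | inl k => p`_(j - k) *+ (k <= j)%N
       | inr k => q`_(j - k) *+ (k <= j)%N end) ->
    \det S = \det (\matrix_(i < N + N, j < N + N)
    (if (i < N)%N then p`_(j - i) *+ (i <= j)%N
     else q`_(j - (i - N)) *+ (i - N <= j)%N)).
  move=> Ep Eq; subst dp dq => SE; congr (\det _); apply/matrixP => i j.
  rewrite SE mxE; case: split_ordP => k ->/=; [by [] |].
  by rewrite addKn.
apply: E; rewrite ?sp ?sq //; exact: Sylvester_mxE.
Qed.

Lemma resultant_rev (A : comNzRingType) (N : nat) (p q p' q' : {poly A}) :
  size p = N.+1 -> size q = N.+1 -> size p' = N.+1 -> size q' = N.+1 ->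
  (forall k, (k <= N)%N -> p'`_k = q`_(N - k)) ->
  (forall k, (k <= N)%N -> q'`_k = p`_(N - k)) ->
  resultant p' q' = resultant p q.
Proof.
move=> sp sq sp' sq' Ep Eq.
have z (u : {poly A}) k : size u = N.+1 -> (N < k)%N -> u`_k = 0.
  by move=> su hk; rewrite nth_default // su.
rewrite (resultantE sp sq) (resultantE sp' sq').
set M' := (X in \det X = _); set M := (X in _ = \det X).
pose s := perm (inv_inj (@rev_ordK (N + N))).
have -> : M' = row_perm s (col_perm s M).
  apply/matrixP => i j; rewrite !mxE !permE /=.
  have hi := ltn_ord i; have hj := ltn_ord j.
  case: (ltnP i N) => hiN.
    have -> : (N + N - i.+1 < N)%N = false by apply/negbTE; lia.
    case: (leqP i j) => hij; last first.
      case: leqP => // h; rewrite ?mulr0n ?mulr1n (z q) //; lia.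
    case: (leqP (j - i) N) => h.
      rewrite Ep //; have -> : (N + N - i.+1 - N <= N + N - j.+1)%N by lia.
      congr (_`_ _ *+ _); lia.
    rewrite (z p') //; case: leqP => // h2; lia.
  have -> : (N + N - i.+1 < N)%N by lia.
  case: (leqP (i - N) j) => hij; last first.
    case: leqP => // h; rewrite ?mulr0n ?mulr1n (z p) //; lia.
  case: (leqP (j - (i - N)) N) => h.
    rewrite Eq //; have -> : (N + N - i.+1 <= N + N - j.+1)%N by lia.
    congr (_`_ _ *+ _); lia.
  rewrite (z q') //; case: leqP => // h2; lia.
by rewrite row_permE col_permE !det_mulmx !det_perm odd_permV mulrCA -signr_addb addbb mulr1.
Qed.

Lemma hC_Sylvester (R : realType) (m n : nat) (a : int -> R[i]) :
  (1 <= n)%N -> a (- m%:Z) * a n%:Z != 0 ->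
  let N := (m + n)%N in
  hC m n a = \det (\matrix_(i < N + N, j < N + N)
    (if (i < N)%N then (gpoly m n a)`_(j - i) *+ (i <= j)%N
     else (gstar m n a)`_(j - (i - N)) *+ (i - N <= j)%N)).
Proof.
move=> n0; rewrite mulf_eq0 negb_or => /andP[am an] /=.
by apply: resultantE; rewrite ?size_gpoly ?size_gstar.
Qed.

Section Real.
Variables (R : realType) (m n : nat) (a : int -> R[i]).
Local Notation C := R[i].
Local Notation cc := (@conjc R : C -> C).

Let sg : {rmorphism {poly {poly C}} -> {poly {poly C}}} :=
  @swapXY C \o map_poly (map_poly cc).

Lemma hC_swap_conj : (1 <= n)%N -> a (- m%:Z) * a n%:Z != 0 ->
  swapXY (map_poly (map_poly cc) (hC m n a)) = hC m n a.
Proof.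
move=> n0; rewrite mulf_eq0 negb_or => /andP[am an].
have sgC c : sg c%:P%:P = (conjc c)%:P%:P.
  by rewrite /sg /= !map_polyC /= map_polyC swapXY_polyC map_polyC.
have sgX : sg 'X = 'Y by rewrite /sg /= map_polyX swapXY_X.
have sgY : sg 'Y = 'X by rewrite /sg /= map_polyC /= map_polyX swapXY_Y.
have inj : injective sg.
  move=> u v /(congr1 (@swapXY C)); rewrite /sg /= !swapXYK.
  apply: (can_inj (g := map_poly (map_poly cc))) => w.
  rewrite -map_poly_comp map_poly_id // => v1 _ /=.
  by rewrite -map_poly_comp map_poly_id // => c _ /=; rewrite conjcK.
have sg0 u : u != 0 -> sg u != 0.
  by apply: contraNneq => h; apply/eqP/inj; rewrite h rmorph0.
rewrite -[LHS]/(sg (hC m n a)) /hC map_resultant; last 2 first.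
- by apply: sg0; rewrite lead_coef_eq0 -size_poly_eq0 size_gpoly.
- by apply: sg0; rewrite lead_coef_eq0 -size_poly_eq0 size_gstar.
have sz u : size (map_poly sg u) = size u.
  by rewrite size_map_inj_poly // /sg /= !rmorph0.
have sgB x y : sg (x - y) = sg x - sg y by rewrite /sg /= !rmorphB.
have sgMn x k : sg (x *+ k) = sg x *+ k by rewrite /sg /= !rmorphMn.
apply: (@resultant_rev _ (m + n)); rewrite ?sz ?size_gpoly ?size_gstar //.
  move=> k hk; rewrite coef_map coef_gpoly // coef_gstar ?leq_subr //.
  rewrite [LHS]sgB sgMn sgC sgX; congr ((conjc (a _))%:P%:P - _ *+ _); lia.
move=> k hk; rewrite coef_map coef_gstar // coef_gpoly ?leq_subr //.
rewrite [LHS]sgB sgMn sgC sgY conjcK; congr ((a _)%:P%:P - _ *+ _); lia.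
Qed.

Lemma hsub_conj : (1 <= n)%N -> a (- m%:Z) * a n%:Z != 0 ->
  map_poly (map_poly cc) (hsub m n a) = hsub m n a.
Proof.
move=> n0 an; rewrite /hsub -{2}(hC_swap_conj n0 an) /subst2.
set u := hC m n a; set s := 'X + _; set t := 'X - _.
have -> : map_poly (map_poly (polyC \o polyC))
    (swapXY (map_poly (map_poly cc) u)) =
  swapXY (map_poly (map_poly (polyC \o polyC)) (map_poly (map_poly cc) u)).
  by rewrite !swapXY_map.
rewrite horner2_swapXY -horner_map -horner_map /=.
have ec : map_poly (map_poly cc) ('i%C%:P%:P) = - 'i%C%:P%:P.
  rewrite !map_polyC /= map_polyC -!polyCN; congr (_%:P%:P).
  by apply/eqP; rewrite eq_complex /= oppr0 !eqxx.
have es : map_poly (map_poly cc) s = t.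
  by rewrite rmorphD rmorphM /= ec mulNr map_polyX map_polyC /= map_polyX.
have et : map_poly (map_poly cc) t = s.
  by rewrite rmorphB rmorphM /= ec mulNr opprK map_polyX map_polyC /= map_polyX.
rewrite et map_polyC /= es; congr (_.[_, _]).
rewrite -!map_poly_comp; apply: eq_map_poly => v /=.
rewrite -!map_poly_comp; apply: eq_map_poly => c /=.
by rewrite map_polyC /= map_polyC.
Qed.

Lemma hpolyE : (1 <= n)%N -> a (- m%:Z) * a n%:Z != 0 ->
  map_poly (map_poly (real_complex R)) (hpoly m n a) = hsub m n a.
Proof.
move=> n0 an; have := hsub_conj n0 an; rewrite /hpoly.
move: (hsub m n a) => u E; apply/polyP => i; apply/polyP => j.
have R0 : complex.Re (0 : C) = 0 by [].
have R00 : map_poly (@complex.Re R) 0 = 0 by rewrite map_poly0.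
have Eij : conjc (u`_i`_j) = u`_i`_j by rewrite -{2}E !(coef_map, coef_map_id0).
rewrite coef_map /= coef_map /= (coef_map_id0 _ _ R00) (coef_map_id0 _ _ R0).
case: (u`_i`_j) Eij => x y [] /= /eqP; rewrite eq_sym -addr_eq0 -mulr2n.
by rewrite mulrn_eq0 /= => /eqP ->.
Qed.

End Real.

(* Main.v *)
Require Import Defs.
From HB Require Import structures.
From mathcomp Require Import all_boot all_order all_algebra.
From mathcomp Require Import complex zify.
From mathcomp Require Import boolp classical_sets functions cardinality reals.

(** Let [F] and [G] be the resultants [hC] of the two Laurent polynomials,
    viewed as polynomials in the independent variables [w] and [wbar]. If [w]
    is a value of [p] on the unit circle, then [z^m (p(z) - w)] and its
    reciprocal share the root [z], so that [(w, conj w)] is a zero of [F]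
    ([hC_laurent]). It thus suffices to bound the number of common zeros of [F]
    and [G] in the plane.

    In the Sylvester matrix of [F], [w] occurs in the first half of the rows
    only, [wbar] in the second half only, and all occurrences lie in [2 n]
    consecutive columns. Hence [F] has degree at most [m + n] in each variable
    and total degree at most [2 n]: its Newton polygon lies in a triangle of
    side [2 n] from which two corners of side [n - m] have been cut off. The
    mixed area of two such hexagons is [4 n s - 2 (n - m) (s - r)], which is
    Bernstein's bound on the number of isolated common zeros.

    This case of Bernstein's theorem is proved by a dimension count
    ([dimension_count]). Let [V(P)] be the space of the polynomials supported in
    a hexagon [P] and let [T] be the sum of the hexagons of [F] and [G] and of
    a large square. Evaluation maps [V(T)] onto the functions on the set of
    common zeros, and kills the image of the map [(A, B) |-> F A - G B] from
    [V(T - F) x V(T - G)]. Since [F] and [G] are coprime, the kernel of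
    this map consists of the multiples [(G C, F C)] of the trivial syzygy, with
    [C] in [V(T - F - G)] because the degrees are additive. So the number of
    zeros is at most the alternating sum of the numbers of lattice points of
    [T], [T - F], [T - G] and [T - F - G], and this is the mixed area
    ([bezout_hexagon]). The argument needs hexagons which fit [F] and [G]
    exactly; the mixed area being monotone, the bound for larger hexagons
    follows ([bezout_bound]).

    The only consequence of coprimality in use, namely that [F A = G B] forces
    [G] to divide [A], is proved for [h] over the real numbers by Gauss's lemma
    ([coprime_syzygy]). It passes to complex coefficients by separating real and
    imaginary parts ([syzygy_complex]), and then to the variables [w] and
    [wbar] by the linear substitution [w = x + i y], [wbar = x - i y]
    ([syzygy_subst_xy]). *)

Set Implicit Arguments.
Unset Strict Implicit.
Unset Printing Implicit Defensive.

Import Order.TTheory GRing.Theory Num.Theory.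
Local Open Scope ring_scope.

(** * Syzygies of coprime bivariate polynomials *)

Section Syzygies.
Variable K : fieldType.
Implicit Types (p l : {poly K}) (A B C F G u v w : {poly {poly K}}).

Lemma ex_irreducible_dvd p : (1 < size p)%N ->
  exists2 d, irreducible_poly d & d %| p.
Proof.
have [n] := ubnP (size p); elim: n p => // n IHn p le_pn p1.
case: (pselect (exists2 d : {poly K}, size d != 1%N &
    (d %| p) && (size d < size p)%N)).
  case=> d d1 /andP[dp ltdp].
  have d0 : d != 0.
    apply: contraTneq dp => ->; rewrite dvd0p -size_poly_eq0.
    by case: size p1.
  have {}d1 : (1 < size d)%N by rewrite ltn_neqAle eq_sym d1 size_poly_gt0.
  have [|e ie ed] := IHn d _ d1; first exact: leq_trans ltdp _.
  by exists e => //; apply: dvdp_trans dp.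
move=> np; exists p => //; split=> // d d1 dp.
rewrite -dvdp_size_eqp // eqn_leq dvdp_leq ?(leqNgt (size p)) //=; last first.
  by rewrite -size_poly_gt0 ltnW.
by apply/negP => lt; apply: np; exists d; rewrite ?dp.
Qed.

Lemma poly_dvd_coef l u : (forall i, l %| u`_i) -> exists v, u = l *: v.
Proof.
move=> lu; exists (\poly_(i < size u) (u`_i %/ l)); apply/polyP => i.
rewrite coefZ coef_poly; case: ltnP => [_|/(nth_default 0)->].
  by rewrite mulrC divpK.
by rewrite mulr0.
Qed.

(** Gauss's lemma: an irreducible polynomial of [K[y]] is prime in
    [K[y][x]]. *)
Lemma irreducible_content l u v w : irreducible_poly l -> u * v = l *: w ->
  (exists u', u = l *: u') \/ (exists v', v = l *: v').
Proof.
move=> il uv; have l0 := irredp_neq0 il.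
(* Reducing the coefficients modulo [l] leaves a leading coefficient which is
   divisible by [l] only if it vanishes. *)
pose red u : {poly {poly K}} := map_poly (fun c : {poly K} => c %% l) u.
have redE u0 : exists u1, u0 = l *: u1 + red u0.
  have [|u1 E] := @poly_dvd_coef l (u0 - red u0).
    move=> i; rewrite coefB coef_map_id0 ?mod0p //.
    by rewrite {1}(divp_eq u0`_i l) addrK dvdp_mull.
  by exists u1; rewrite -E subrK.
have lead_red u0 : l %| lead_coef (red u0) -> red u0 = 0.
  move=> dl; apply/eqP; rewrite -lead_coef_eq0.
  move: dl; rewrite lead_coefE coef_map_id0 ?mod0p //.
  by rewrite /dvdp modp_id.
have [u1 Eu] := redE u; have [v1 Ev] := redE v.
have : l %| lead_coef (red u * red v).
  have -> : red u * red v = l *: (w - u1 * v - red u * v1).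
    have Eu' : red u = u - l *: u1 by rewrite {2}Eu addrC addKr.
    have Ev' : red v = v - l *: v1 by rewrite {2}Ev addrC addKr.
    by rewrite Ev' mulrBr {1}Eu' mulrBl uv !scalerBr -scalerAl -scalerAr.
  by rewrite lead_coefZ dvdp_mulr.
rewrite lead_coefM; case: (boolP (l %| lead_coef (red u))) => [lu _|nlu].
  by left; exists u1; rewrite {1}Eu lead_red ?addr0.
rewrite Gauss_dvdpr ?irreducible_poly_coprime // => lv.
by right; exists v1; rewrite {1}Ev lead_red ?addr0.
Qed.

Lemma scale_poly_inj (l : {poly K}) : l != 0 ->
  injective (fun u : {poly {poly K}} => l *: u).
Proof.
move=> l0 u v /=; rewrite -!mul_polyC => /mulfI; apply.
by rewrite polyC_eq0.
Qed.

(** Two coprime bivariate polynomials admit no other syzygy than the multiples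
    of the obvious one. *)
Lemma coprime_syzygy F G : F != 0 -> G != 0 ->
  ~ have_nonconstant_common_factor F G ->
  forall A B, F * A = G * B -> exists C, A = G * C.
Proof.
move=> F0 G0 nFG.
pose syz A B := A != 0 /\ F * A = G * B.
(* A syzygy whose first component has least degree, and then a leading
   coefficient of least degree. *)
have [A0 [B0 [syz0 minA minl]]] : exists A0 B0, [/\ syz A0 B0,
    forall A B, syz A B -> (size A0 <= size A)%N
  & forall A B, syz A B -> size A = size A0 ->
      (size (lead_coef A0) <= size (lead_coef A))%N].
  have ex1 : exists s, `[< exists A B, syz A B /\ size A = s >].
    by exists (size G); apply/asboolP; exists G, F; rewrite /syz mulrC.
  case: (ex_minnP ex1) => s /asboolP[A1 [B1 [syz1 sA1]]] mins.
  have ex2 : exists t, `[< exists A B, [/\ syz A B, size A = s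
      & size (lead_coef A) = t] >].
    by exists (size (lead_coef A1)); apply/asboolP; exists A1, B1.
  case: (ex_minnP ex2) => t /asboolP[A0 [B0 [syz0 sA0 tA0]]] mint.
  exists A0, B0; split=> // A B AB; rewrite ?sA0 ?tA0.
    by apply: mins; apply/asboolP; exists A, B.
  by move=> sA; apply: mint; apply/asboolP; exists A, B.
have [A00 E0] := syz0.
(* Dividing [A0] and [B0] by a nonconstant scalar, that is an element of [K[y]],
   would lower the degree of the leading coefficient of [A0]. *)
have primitive l A1 B1 : irreducible_poly l -> A0 = l *: A1 -> B0 = l *: B1 ->
    False.
  move=> il EA EB; have l0 := irredp_neq0 il.
  have A10 : A1 != 0 by apply: contraNneq A00 => E; rewrite EA E scaler0.
  have syz1 : syz A1 B1.
    by split=> //; apply: (scale_poly_inj l0); rewrite /= !scalerAr -EA -EB.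
  have sA : size A1 = size A0 by rewrite EA size_scale.
  have := minl _ _ syz1 sA; rewrite EA lead_coefZ size_mul ?lead_coef_eq0 //.
  have : (0 < size (lead_coef A1))%N by rewrite size_poly_gt0 lead_coef_eq0.
  have aux x y : (1 < x -> 0 < y -> (x + y).-1 <= y -> False)%N by lia.
  by case: il => l1 _; apply: aux.
(* Gauss's lemma removes the irreducible factors of [l] one after the other. *)
have cancel_scalar n l (q A B : {poly {poly K}}) : (size l <= n)%N -> l != 0 ->
    l *: A = q * A0 -> l *: B = q * B0 -> exists C, A = C * A0 /\ B = C * B0.
  elim: n l q => [|n IHn] l q.
    by rewrite leqn0 size_poly_eq0 => /eqP->; rewrite eqxx.
  move=> ln l0 EA EB; case: (ltnP 1 (size l)) => [l1|]; last first.
    move=> l1; have /size_poly1P[c c0 El] : size l == 1%N.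
      by rewrite eqn_leq l1 size_poly_gt0.
    exists (c^-1%:P%:P * q); rewrite -!mulrA -EA -EB El.
    by rewrite -!mul_polyC !mulrA -!polyCM mulVf // !mul1r.
  have [d id dl] := ex_irreducible_dvd l1; have d0 := irredp_neq0 id.
  pose l' := l %/ d; have El : l = d * l' by rewrite mulrC divpK.
  have l'0 : l' != 0 by apply: contraNneq l0 => E; rewrite El E mulr0.
  have ltl' : (size l' <= n)%N.
    have l'_gt0 : (0 < size l')%N by rewrite size_poly_gt0.
    have aux x y z k : (z = (x + y).-1 -> 1 < x -> 0 < y -> z <= k.+1 ->
      y <= k)%N by lia.
    apply: (aux (size d) (size l')) ln => //; first by rewrite El size_mul.
    by case: id.
  rewrite El -!scalerA in EA EB.
  have [q' Eq] : exists q' : {poly {poly K}}, q = d *: q'.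
    have [//|[A1 EA1]] := irreducible_content id (esym EA).
    have [//|[B1 EB1]] := irreducible_content id (esym EB).
    by case: (primitive d A1 B1).
  apply: (IHn l' q') => //; apply: (scale_poly_inj d0).
    by rewrite /= EA Eq scalerAl.
  by rewrite /= EB Eq scalerAl.
(* By pseudo-division, every syzygy is a multiple of [(A0, B0)] up to a
   scalar. *)
have gen A B : F * A = G * B -> exists C, A = C * A0 /\ B = C * B0.
  move=> AB; pose l := lead_coef A0 ^+ scalp A A0; pose q := A %/ A0.
  have l0 : l != 0 by rewrite expf_neq0 // lead_coef_eq0.
  have EA : l *: A = q * A0.
    rewrite /l Pdiv.Idomain.divp_eq; set rem := A %% A0.
    suff -> : rem = 0 by rewrite addr0.
    apply/eqP/negPn/negP => r0.
    suff /minA : syz rem (l *: B - q * B0) by rewrite leqNgt ltn_modp A00.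
    split=> //; have -> : rem = l *: A - q * A0.
      by rewrite /l Pdiv.Idomain.divp_eq addrAC subrr add0r.
    by rewrite !mulrBr -!scalerAr AB !(mulrCA _ q) E0.
  apply: (@cancel_scalar (size l) l q) => //.
  apply: (mulfI G0); rewrite -scalerAr -AB scalerAr EA.
  by rewrite mulrCA E0 mulrCA.
(* For the trivial syzygy [(G, F)], the multiplier is a common factor. *)
have [C0 [EG EF]] := gen G F (mulrC F G).
have [c Ec] : exists c : K, C0 = c%:P%:P.
  case: (pselect (exists c : K, C0 = c%:P%:P)) => // nc; case: nFG.
  exists C0; split; last by exists A0.
    by move=> c Ec; apply: nc; exists c.
  by exists B0.
have c0 : c != 0.
  by apply: contraNneq G0 => E; rewrite EG Ec E !polyC0 mul0r.
move=> A B /gen[C [-> _]]; exists (c^-1%:P%:P * C).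
by rewrite EG Ec mulrACA -!polyCM mulfV // !polyC1 mul1r mulrC.
Qed.

End Syzygies.

(** * The dimension count *)

Section DimensionCount.
Variable K : fieldType.
Implicit Types (A B C F G u : {poly {poly K}}) (Q : seq (nat * nat)).

(** The exponents of [u] belong to [Q]; the first component is the exponent of
    the outer variable. *)
Definition supported Q u := forall i j, u`_i`_j != 0 -> (i, j) \in Q.

(** Coordinates of the polynomials supported in [Q], along the monomials listed
    in [Q]: [poly_of_row] and [row_of_poly] are inverse bijections when [Q] has
    no duplicates. *)
Definition poly_of_row Q (v : 'rV[K]_(size Q)) : {poly {poly K}} :=
  \sum_(k < size Q)
    (v 0 k *: 'X^((nth (0, 0)%N Q k).2)) *: 'X^((nth (0, 0)%N Q k).1).

Definition row_of_poly Q u : 'rV[K]_(size Q) :=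
  \row_k u`_(nth (0, 0)%N Q k).1`_(nth (0, 0)%N Q k).2.

Lemma coef_poly_of_row Q (v : 'rV_(size Q)) i j :
  (poly_of_row v)`_i`_j =
  \sum_(k < size Q) v 0 k *+ ((i, j) == nth (0, 0)%N Q k).
Proof.
rewrite !coef_sum; apply: eq_bigr => k _.
rewrite coefZ coefXn -[(i, j) == _]/((i == _) && (j == _)).
by case: (i == _); rewrite ?mulr1 ?mulr0 ?coef0 // coefZ coefXn mulr_natr.
Qed.

Lemma poly_of_rowK Q : uniq Q -> cancel (@poly_of_row Q) (row_of_poly Q).
Proof.
move=> uQ v; apply/rowP => k; rewrite mxE coef_poly_of_row -surjective_pairing.
rewrite (bigD1 k) //= eqxx big1 ?addr0 // => l lk.
by rewrite nth_uniq // eq_sym; move: lk; rewrite -val_eqE /= => /negPf->.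
Qed.

Lemma supported_poly_of_row Q (v : 'rV_(size Q)) : supported Q (poly_of_row v).
Proof.
move=> i j; rewrite coef_poly_of_row; apply: contraR => ijQ; apply/eqP.
rewrite big1 // => k _; case: eqP => // E.
by rewrite E mem_nth in ijQ.
Qed.

Lemma row_of_polyK Q u : uniq Q -> supported Q u ->
  poly_of_row (row_of_poly Q u) = u.
Proof.
move=> uQ sup; apply/polyP => i; apply/polyP => j.
have [ijQ|ijQ] := boolP ((i, j) \in Q); last first.
  have -> : u`_i`_j = 0 by apply/eqP/negPn/negP => /sup; apply/negP.
  apply/eqP; apply: contraR ijQ; exact: supported_poly_of_row.
have := ijQ; rewrite -index_mem => lt; pose k := Ordinal lt.
have Ek : nth (0, 0)%N Q k = (i, j) by rewrite nth_index.
have := poly_of_rowK uQ (row_of_poly Q u) => /rowP/(_ k).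
by rewrite !mxE Ek.
Qed.

Lemma row_of_poly_linear Q c u v :
  row_of_poly Q (c%:P *: u + v) = c *: row_of_poly Q u + row_of_poly Q v.
Proof. by apply/rowP => k; rewrite !mxE coefD coefZ coefD coefCM. Qed.

Lemma poly_of_row_linear Q c (u v : 'rV_(size Q)) :
  poly_of_row (c *: u + v) = c%:P *: poly_of_row u + poly_of_row v.
Proof.
rewrite scaler_sumr -big_split; apply: eq_bigr => k _ /=.
by rewrite !mxE scalerDl scalerDl scalerA mul_polyC scalerA.
Qed.

Lemma linear_mx m n (f : 'rV[K]_m -> 'rV[K]_n) : linear f ->
  exists M, forall v, v *m M = f v.
Proof.
move=> lf; pose g : {linear 'rV_m -> 'rV_n} :=
  HB.pack_for {linear 'rV_m -> 'rV_n} f (GRing.isLinear.Build _ _ _ _ f lf).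
by exists (lin1_mx g) => v; rewrite mul_rV_lin1.
Qed.

(** Writing [V(Q)] for the space of the polynomials supported in [Q], consider
    the maps [V(QC) -> V(QA) x V(QB) -> V(QT) -> K^s] given by
    [C |-> (G C, F C)], [(A, B) |-> F A - G B] and evaluation at the points of
    [s]. The hypotheses say that the last map is onto, that its composite with
    the second one is zero, and that the kernel of the second map lies in the
    image of the first. *)
Lemma dimension_count F G (QT QA QB QC : seq (nat * nat)) (s : seq (K * K)) :
    uniq QT -> uniq QA -> uniq QB -> uniq QC ->
    (forall A, supported QA A -> supported QT (F * A)) ->
    (forall B, supported QB B -> supported QT (G * B)) ->
    (forall A B, supported QA A -> supported QB B -> F * A = G * B ->
      exists C, [/\ supported QC C, A = G * C & B = F * C]) ->
    (forall x, x \in s -> F.[x.1, x.2] = 0 /\ G.[x.1, x.2] = 0) ->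
    uniq s ->
    (forall x, x \in s -> exists u, [/\ supported QT u, u.[x.1, x.2] != 0
       & forall y, y \in s -> y != x -> u.[y.1, y.2] = 0]) ->
  (size s + size QA + size QB <= size QT + size QC)%N.
Proof.
move=> uT uA uB uC FA GB syz zs us interp.
pose comb (v : 'rV[K]_(size QA + size QB)) :=
  row_of_poly QT (F * poly_of_row (lsubmx v) - G * poly_of_row (rsubmx v)).
have comb_lin : linear comb.
  move=> c u v; rewrite /comb -row_of_poly_linear !linearP /=.
  rewrite !poly_of_row_linear; congr row_of_poly.
  rewrite !mulrDr -!scalerAr scalerBr opprD.
  by rewrite addrACA.
have [Mc McE] := linear_mx comb_lin.
pose pt (k : 'I_(size s)) := nth (0, 0) s k.
pose eval (v : 'rV[K]_(size QT)) : 'rV[K]_(size s) :=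
  \row_k (poly_of_row v).[(pt k).1, (pt k).2].
have eval_lin : linear eval.
  move=> c u v; apply/rowP => k; rewrite !mxE poly_of_row_linear.
  by rewrite !hornerE.
have [Me MeE] := linear_mx eval_lin.
pose diag (v : 'rV[K]_(size QC)) : 'rV[K]_(size QA + size QB) :=
  row_mx (row_of_poly QA (G * poly_of_row v))
         (row_of_poly QB (F * poly_of_row v)).
have diag_lin : linear diag.
  move=> c u v; rewrite /diag poly_of_row_linear !mulrDr -!scalerAr.
  by rewrite !row_of_poly_linear scale_row_mx add_row_mx.
have [Md MdE] := linear_mx diag_lin.
have supD Q u v : supported Q u -> supported Q v -> supported Q (u - v).
  move=> su sv i j; rewrite !coefB => uv; have [u0|/su //] := eqVneq u`_i`_j 0.
  by apply: sv; rewrite u0 sub0r oppr_eq0 in uv.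
have rank_e : \rank Me = size s.
  suff : row_full Me by move/eqP.
  rewrite -sub1mx; apply/row_subP => k.
  have [|u [uT' ux uy]] := interp (pt k); first by rewrite mem_nth.
  apply/submxP; exists ((u.[(pt k).1, (pt k).2])^-1 *: row_of_poly QT u).
  rewrite -scalemxAl MeE; apply/rowP => l.
  rewrite !mxE row_of_polyK // -/(pt l).
  have [<-|kl] := eqVneq k l; first by rewrite mulVf.
  rewrite (uy (pt l)) ?mulr0 ?mulr0n ?mem_nth //; apply: contraNneq kl => E.
  by apply/eqP/val_inj/eqP; rewrite /= -(nth_uniq (0, 0) _ _ us) // -/(pt l) E.
have McMe : Mc *m Me = 0.
  apply/row_matrixP => i; rewrite row0 row_mul rowE -mulmxA mulmxA McE MeE.
  apply/rowP => k; rewrite !mxE row_of_polyK //.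
    have [Fk Gk] := zs (pt k) (mem_nth _ (ltn_ord k)).
    by rewrite !hornerE Fk Gk !mul0r subr0.
  by apply: supD; [apply: FA | apply: GB]; apply: supported_poly_of_row.
have rank_k : (\rank (kermx Mc) <= size QC)%N.
  apply: leq_trans (rank_leq_row Md); apply: mxrankS; apply/row_subP => i.
  set v := row i _; have : v *m Mc = 0 by rewrite -row_mul mulmx_ker row0.
  rewrite McE => v0.
  have E : F * poly_of_row (lsubmx v) = G * poly_of_row (rsubmx v).
    apply/eqP; rewrite -subr_eq0 -[X in X == _](row_of_polyK uT); last first.
      by apply: supD; [apply: FA | apply: GB]; apply: supported_poly_of_row.
    rewrite -/(comb v) v0; apply/eqP; rewrite /poly_of_row big1 // => k _.
    by rewrite mxE !scale0r.
  have [||C [sC EA EB]] := syz _ _ _ _ E; try exact: supported_poly_of_row.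
  apply/submxP; exists (row_of_poly QC C); rewrite MdE /diag row_of_polyK //.
  by rewrite -EA -EB !poly_of_rowK // hsubmxK.
have := mulmx0_rank_max McMe; rewrite rank_e; move: rank_k; rewrite mxrank_ker.
by have := rank_leq_row Mc; lia.
Qed.

End DimensionCount.

(** * Bernstein's bound for hexagons *)

(** The lattice points [(i, j)] with [i <= p], [j <= q] and [i + j <= d], when
    [p <= d]. *)
Definition hexagon (p q d : nat) : seq (nat * nat) :=
  [seq (i, j) | i <- iota 0 p.+1, j <- iota 0 (minn q (d - i)).+1].

Lemma mem_hexagon p q d i j : (p <= d)%N ->
  ((i, j) \in hexagon p q d) = [&& i <= p, j <= q & i + j <= d]%N.
Proof.
move=> pd.
apply/allpairsPdep/idP => [[i' [j' [+ + [-> ->]]]]|/and3P[ip jq ijd]].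
  by rewrite !mem_iota; lia.
by exists i, j; rewrite !mem_iota; split=> //; lia.
Qed.

Lemma hexagon_uniq p q d : uniq (hexagon p q d).
Proof.
apply: allpairs_uniq_dep => [|i _|[i j] [i' j'] _ _ [-> ->]] //;
  exact: iota_uniq.
Qed.

(** A rectangle of [(p + 1) (q + 1)] points, from which a triangular corner of
    side [p + q - d] is removed. *)
Lemma size_hexagon p q d : (p <= d)%N -> (q <= d)%N ->
  ((size (hexagon p q d)).*2 + (p + q - d) * (p + q - d).+1
    = (p.+1 * q.+1).*2)%N.
Proof.
move=> pd qd; rewrite size_allpairs_dep sumnE big_map.
under eq_bigr => i _ do rewrite size_iota.
rewrite -[X in iota _ X]subn0 -/(index_iota 0 p.+1).
elim: p pd => [|p IHp] pd; first by rewrite big_nat1; lia.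
have := IHp (ltnW pd); rewrite [in X in _ -> X]big_nat_recr //=.
set S := \sum_(0 <= i < p.+1) _.
have [h|h] := leqP (p.+1 + q) d.
  have [-> ->] : (p + q - d = 0 /\ p.+1 + q - d = 0)%N by lia.
  by nia.
have -> : (p.+1 + q - d = (p + q - d).+1)%N by lia.
by nia.
Qed.

Section Degrees.
Variable K : fieldType.
Implicit Types (A B C F G u v : {poly {poly K}}).

(** For [u(x, y)], the polynomial [u(t x, t)] in [t] (outer variable) and [x]
    (inner variable): its degree in [t] is the total degree of [u]. *)
Definition homogenize u : {poly {poly K}} := swapXY (u \Po ('X *: 'X)).

Lemma homogenizeM u v : homogenize (u * v) = homogenize u * homogenize v.
Proof. by rewrite /homogenize !rmorphM. Qed.

(** One more than the total degree, and 0 for the zero polynomial. *)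
Definition totsize u := size (homogenize u).

Lemma coef_homogenize u k i :
  (homogenize u)`_k`_i = if (k < i)%N then 0 else u`_i`_(k - i).
Proof.
rewrite coef_swapXY coef_comp_poly.
transitivity ((u`_i * 'X^i)`_k); last by rewrite coefMXn.
congr (_ `_ k).
have E (l : nat) : (('X *: 'X : {poly {poly K}}) ^+ l)`_i = 'X^l *+ (i == l).
  by rewrite exprZn coefZ coefXn mulr_natr.
under eq_bigr => l _ do rewrite E.
have [lt|ge] := ltnP i (size u).
  rewrite (bigD1 (Ordinal lt)) //= eqxx big1 ?addr0 // => l.
  by rewrite -val_eqE /= eq_sym => /negPf->; rewrite mulr0.
rewrite big1 ?(nth_default _ ge) ?mul0r // => l _.
by case: eqP (ltn_ord l) => [<-|]; rewrite ?mulr0 // ltnNge ge.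
Qed.

Lemma homogenize_eq0 u : (homogenize u == 0) = (u == 0).
Proof.
apply/eqP/eqP => [u0|->]; last by rewrite /homogenize !rmorph0.
apply/polyP => i; apply/polyP => j; rewrite !coef0.
have := coef_homogenize u (i + j) i.
by rewrite u0 !coef0 addKn ltnNge leq_addr => /= <-.
Qed.

Lemma size_leP u k : (size u <= k)%N <-> forall i j, u`_i`_j != 0 -> (i < k)%N.
Proof.
split=> [le i j|H].
  apply: contraR; rewrite -leqNgt => /(leq_trans le)/(nth_default 0)->.
  by rewrite coef0.
apply/leq_sizeP => i ki; apply/polyP => j; rewrite coef0; apply/eqP/negPn/negP.
by move/H; rewrite ltnNge ki.
Qed.

Lemma sizeY_leP u k :
  (sizeY u <= k)%N <-> forall i j, u`_i`_j != 0 -> (j < k)%N.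
Proof.
rewrite sizeYE; split=> [/size_leP H i j|H].
  by rewrite -coef_swapXY => /H.
by apply/size_leP => i j; rewrite coef_swapXY => /H.
Qed.

Lemma totsize_leP u k :
  (totsize u <= k)%N <-> forall i j, u`_i`_j != 0 -> (i + j < k)%N.
Proof.
split=> [/size_leP H i j uij|H].
  by apply: (H _ i); rewrite coef_homogenize addKn ltnNge leq_addr.
apply/size_leP => l i; rewrite coef_homogenize.
case: ltnP => [|il]; first by rewrite eqxx.
by move/H; rewrite subnKC.
Qed.

Lemma supported_hexagon p q d u : (p <= d)%N ->
  supported (hexagon p q d) u <->
  [/\ size u <= p.+1, sizeY u <= q.+1 & totsize u <= d.+1]%N.
Proof.
move=> pd; split=> [H|[/size_leP Hp /sizeY_leP Hq /totsize_leP Hd] i j u0].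
  split; [apply/size_leP|apply/sizeY_leP|apply/totsize_leP] => i j /H;
  by rewrite mem_hexagon //; lia.
by rewrite mem_hexagon // -ltnS (Hp i j u0) -ltnS (Hq i j u0) -ltnS Hd.
Qed.

Lemma size_sizeY_totsize u : u != 0 ->
  [/\ 0 < size u, 0 < sizeY u, size u <= totsize u, sizeY u <= totsize u
    & totsize u < size u + sizeY u]%N.
Proof.
move=> u0; have H := totsize_leP u (totsize u).
have {}H := H.1 (leqnn _).
have s0 : (0 < size u)%N by rewrite size_poly_gt0.
have y0 : (0 < sizeY u)%N by rewrite lt0n sizeY_eq0.
split=> //.
- by apply/size_leP => i j /H; lia.
- by apply/sizeY_leP => i j /H; lia.
suff : (totsize u <= (size u + sizeY u).-1)%N by lia.
apply/totsize_leP => i j uij.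
have := (size_leP u _).1 (leqnn _) i j uij.
by have := (sizeY_leP u _).1 (leqnn _) i j uij; lia.
Qed.

Lemma sizeY_mul u v : u != 0 -> v != 0 ->
  sizeY (u * v) = (sizeY u + sizeY v).-1.
Proof.
by move=> u0 v0; rewrite !sizeYE rmorphM size_mul ?swapXY_eq0.
Qed.

Lemma totsize_mul u v : u != 0 -> v != 0 ->
  totsize (u * v) = (totsize u + totsize v).-1.
Proof.
by move=> u0 v0; rewrite /totsize homogenizeM size_mul ?homogenize_eq0.
Qed.

Lemma supported0 Q : supported Q (0 : {poly {poly K}}).
Proof. by move=> i j; rewrite !coef0 eqxx. Qed.

Lemma size_prod_XsubC_filter (T : Type) (f : T -> K) (P : pred T) (s : seq T) :
  (size (\prod_(y <- s | P y) ('X - (f y)%:P))%R <= (size s).+1)%N.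
Proof. by rewrite -big_filter size_prod_XsubC ltnS size_filter count_size. Qed.

Lemma interpolation (s : seq (K * K)) x : exists u : {poly {poly K}},
  [/\ forall i j, u`_i`_j != 0 -> (i <= size s)%N /\ (j <= size s)%N,
      u.[x.1, x.2] != 0
    & forall y, y \in s -> y != x -> u.[y.1, y.2] = 0].
Proof.
pose U := \prod_(y <- s | y.1 != x.1) ('X - y.1%:P).
pose V := \prod_(y <- s | y.2 != x.2) ('X - y.2%:P).
exists (V *: U^:P).
have ev a b : (V *: U^:P).[a, b] = V.[b] * U.[a].
  by rewrite hornerZ hornerM horner_map hornerC.
split=> [i j||y ys yx]; rewrite ?ev.
- rewrite coefZ coef_map coefMC => uij; split; rewrite -ltnS.
    apply: leq_trans (size_prod_XsubC_filter fst (fun y => y.1 != x.1) s).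
    by rewrite ltnNge; apply: contraNN uij => /(nth_default 0)->; rewrite mulr0.
  apply: leq_trans (size_prod_XsubC_filter snd (fun y => y.2 != x.2) s).
  by rewrite ltnNge; apply: contraNN uij => /(nth_default 0)->; rewrite mul0r.
- rewrite mulf_neq0 // horner_prod prodf_seq_neq0; apply/allP => y _;
  by apply/implyP => yx; rewrite hornerXsubC subr_eq0 eq_sym.
- apply/eqP; rewrite mulf_eq0.
  have : (y.1 != x.1) || (y.2 != x.2).
    by rewrite -negb_and; apply: contraNN yx; case: (x) (y) => ? ? [? ?].
  case/orP => ne; apply/orP; [right|left]; rewrite horner_prod prodf_seq_eq0;
  by apply/hasP; exists y => //; rewrite ne hornerXsubC subrr eqxx.
Qed.

(** Bernstein's bound when [(p, q, d)] and [(p', q', d')] are the exact partial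
    and total degrees of [F] and [G]; the right-hand side minus the product on
    the left is the mixed area of the two hexagons. *)
Lemma bezout_hexagon F G (s : seq (K * K)) p q d p' q' d' :
    (forall A B, F * A = G * B -> exists C, A = G * C) ->
    size F = p.+1 -> sizeY F = q.+1 -> totsize F = d.+1 ->
    size G = p'.+1 -> sizeY G = q'.+1 -> totsize G = d'.+1 ->
    uniq s -> (forall x, x \in s -> F.[x.1, x.2] = 0 /\ G.[x.1, x.2] = 0) ->
  (size s + (p + q - d) * (p' + q' - d') <= p * q' + p' * q)%N.
Proof.
move=> syz sF yF tF sG yG tG us zs; pose k := size s.
have F0 : F != 0 by rewrite -size_poly_eq0 sF.
have G0 : G != 0 by rewrite -size_poly_eq0 sG.
have [_ _ + + +] := size_sizeY_totsize F0.
have [_ _ + + +] := size_sizeY_totsize G0.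
rewrite sF yF tF sG yG tG => pd' qd' dpq' pd qd dpq.
(* As the degrees are additive, multiplication by a nonzero polynomial both
   translates and reflects membership in a hexagon. *)
have mulF A B' a b c a' b' c' : B' != 0 -> (a' <= c')%N ->
    size B' = a.+1 -> sizeY B' = b.+1 -> totsize B' = c.+1 ->
    (a <= c)%N ->
    supported (hexagon a' b' c') A <->
    supported (hexagon (a + a') (b + b') (c + c')) (B' * A).
  move=> B0 ac' sB yB tB ac.
  have [->|A0] := eqVneq A 0.
    by rewrite mulr0; split=> _; apply: supported0.
  rewrite !supported_hexagon ?leq_add //.
  rewrite size_mul // sizeY_mul // totsize_mul //.
  rewrite sB yB tB !addSn /= -!addnS !leq_add2l.
  by [].
(* The large square has side [k], as Lagrange interpolation at [k] points needs
   degree at most [k] in each variable. *)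
have : (size s + size (hexagon (p' + k) (q' + k) (d' + k.*2))
    + size (hexagon (p + k) (q + k) (d + k.*2))
  <= size (hexagon (p + (p' + k)) (q + (q' + k)) (d + (d' + k.*2)))
    + size (hexagon k k k.*2))%N.
  apply: (@dimension_count K F G) => //; try exact: hexagon_uniq.
  - by move=> A; apply: (mulF A F p q d _ _ _ F0 _ sF yF tF pd).1; lia.
  - move=> B; rewrite (addnCA p) (addnCA q) (addnCA d).
    by apply: (mulF B G p' q' d' _ _ _ G0 _ sG yG tG pd').1; lia.
  - move=> A B sA sB AB; have [C EC] := syz _ _ AB; exists C; split=> //.
      apply: (mulF C G p' q' d' _ _ _ G0 _ sG yG tG pd').2; first by lia.
      by rewrite -EC.
    by apply: (mulfI G0); rewrite -AB EC mulrCA.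
  - move=> x xs; have [u [H1 H2 H3]] := interpolation s x.
    exists u; split=> // i j /H1[? ?]; rewrite mem_hexagon; lia.
have := @size_hexagon (p + (p' + k)) (q + (q' + k)) (d + (d' + k.*2)).
have := @size_hexagon (p' + k) (q' + k) (d' + k.*2).
have := @size_hexagon (p + k) (q + k) (d + k.*2).
have := @size_hexagon k k k.*2.
have -> : (k + k - k.*2 = 0)%N by lia.
have -> : (p + k + (q + k) - (d + k.*2) = p + q - d)%N by lia.
have -> : (p' + k + (q' + k) - (d' + k.*2) = p' + q' - d')%N by lia.
have -> : (p + (p' + k) + (q + (q' + k)) - (d + (d' + k.*2))
  = (p + q - d) + (p' + q' - d'))%N by lia.
move: (size (hexagon _ _ _)) (size (hexagon _ _ _)) (size (hexagon _ _ _))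
  (size (hexagon _ _ _)) => X1 X2 X3 X4.
rewrite -/k; clearbody k.
move: (p + q - d)%N (p' + q' - d')%N => c c'.
move=> E1 E2 E3 E4.
have {E1} := E1 ltac:(lia) ltac:(lia).
have {E2} := E2 ltac:(lia) ltac:(lia).
have {E3} := E3 ltac:(lia) ltac:(lia).
have {E4} := E4 ltac:(lia) ltac:(lia).
rewrite -!muln2 !(mulnDl, mulnDr, mulnS, mulSn) => *. lia.
Qed.

(** Bernstein's bound for two symmetric hexagons, the first with sides [M] and
    [D], the second with sides [M'] and [D']. *)
Lemma bezout_bound F G (s : seq (K * K)) M D M' D' :
    F != 0 -> G != 0 ->
    (forall A B, F * A = G * B -> exists C, A = G * C) ->
    (M <= D <= M.*2)%N ->
    (size F <= M.+1)%N -> (sizeY F <= M.+1)%N -> (totsize F <= D.+1)%N ->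
    (size G <= M'.+1)%N -> (sizeY G <= M'.+1)%N -> (totsize G <= D'.+1)%N ->
    uniq s -> (forall x, x \in s -> F.[x.1, x.2] = 0 /\ G.[x.1, x.2] = 0) ->
  (size s <= (D - M) * M'.*2 + (M.*2 - D) * D')%N.
Proof.
move=> F0 G0 syz MD.
have [p0 q0 pd qd dpq] := size_sizeY_totsize F0.
have [p'0 q'0 pd' qd' dpq'] := size_sizeY_totsize G0.
move=> pM qM dD pM' qM' dD' us zs.
have := @bezout_hexagon F G s (size F).-1 (sizeY F).-1 (totsize F).-1
  (size G).-1 (sizeY G).-1 (totsize G).-1 syz.
move: p0 q0 pd qd dpq p'0 q'0 pd' qd' dpq' pM qM dD pM' qM' dD'.
move: (size F) (sizeY F) (totsize F) (size G) (sizeY G) (totsize G).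
move=> [|p] [|q] [|d] [|p'] [|q'] [|d'] //=.
move=> _ _ pd qd dpq _ _ pd' qd' dpq' pM qM dD pM' qM' dD' H.
have {H} := H erefl erefl erefl erefl erefl erefl us zs.
(* With these variables the bound becomes [d * c' + p * x + q * y], which is
   monotone in [p], [q] and [d]. *)
have [c' [x [y [Ep Eq Ed]]]] : exists c' x y,
    [/\ p' = c' + y, q' = c' + x & d' = c' + x + y]%N.
  by exists (p' + q' - d')%N, (d' - p')%N, (d' - q')%N; split; lia.
have -> : (p' + q' - d' = c')%N by lia.
move=> H.
have H1 : (size s <= d * c' + p * x + q * y)%N.
  have Ec : ((p + q - d) * c' + d * c' = p * c' + q * c')%N.
    by rewrite -!mulnDl subnK //; lia.
  rewrite Ep Eq !(mulnDl, mulnDr) (mulnC c' q) (mulnC y q) in H; lia.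
have H2 : (size s <= D * c' + M * x + M * y)%N.
  apply: leq_trans H1 _; rewrite !leq_add // leq_mul //; lia.
apply: leq_trans H2 _.
have [e [f [EM ED]]] : exists e f, (M = e + f /\ D = e + e + f)%N.
  by exists (D - M)%N, (M.*2 - D)%N; split; lia.
have -> : (D - M = e)%N by lia.
have -> : (M.*2 - D = f)%N by lia.
have : (e * (p' + q') <= e * M'.*2)%N by rewrite leq_mul //; lia.
have : (f * d' <= f * D')%N by rewrite leq_mul.
rewrite ED EM Ep Eq Ed !(mulnDl, mulnDr); lia.
Qed.

End Degrees.

(** * The degrees of the resultant *)

Section DeterminantDegree.
Variable A : comNzRingType.

Lemma size_det_rows n (M : 'M[{poly A}]_n) (c : 'I_n -> nat) :
  (forall i j, size (M i j) <= (c i).+1)%N ->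
  (size (\det M) <= (\sum_i c i).+1)%N.
Proof.
move=> Mc; apply: leq_trans (size_sum _ _ _) _; apply/bigmax_leqP => s _.
rewrite size_Msign; apply: leq_trans (size_poly_prod_leq _ _) _.
rewrite leq_subLR cardE size_enum_ord.
apply: leq_trans (_ : _ <= (\sum_i (c i).+1).+1)%N _.
  by rewrite ltnS leq_sum.
under eq_bigr => i _ do rewrite -addn1.
by rewrite big_split /= sum1_card card_ord addnS addnC.
Qed.

Lemma size_det_cols n (M : 'M[{poly A}]_n) (c : 'I_n -> nat) :
  (forall i j, size (M i j) <= (c j).+1)%N ->
  (size (\det M) <= (\sum_j c j).+1)%N.
Proof.
by move=> Mc; rewrite -det_tr; apply: size_det_rows => i j; rewrite mxE.
Qed.

End DeterminantDegree.

Lemma sum_interval N lo hi : (lo <= hi <= N)%N ->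
  (\sum_(j < N) (lo <= j < hi)%N = hi - lo)%N.
Proof.
suff -> : (\sum_(j < N) (lo <= j < hi)%N = minn hi N - minn lo N)%N by lia.
by elim: N => [|N IHN]; rewrite ?big_ord0 ?big_ord_recr /= ?IHN; lia.
Qed.

Section ResultantDegree.
Variables (R : realType) (m n : nat) (a : int -> R[i]).
Hypotheses (n0 : (1 <= n)%N) (an : a (- m%:Z) * a n%:Z != 0).
Hypothesis (mn : (m <= n)%N).
Local Notation C := R[i].
Local Notation N := (m + n)%N.

Let M := \matrix_(i < N + N, j < N + N)
    (if (i < N)%N then (gpoly m n a)`_(j - i) *+ (i <= j)%N
     else (gstar m n a)`_(j - (i - N)) *+ (i - N <= j)%N).

(* Every entry is a constant minus at most one variable: [w] in the upper half,
   [wbar] in the lower one. *)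
Let entry i j : exists c (b1 b2 : bool),
  [/\ M i j = c%:P%:P - 'X *+ b1 - 'Y *+ b2, b1 ==> (i < N)%N,
      b2 ==> (N <= i)%N & b1 || b2 ==> (m <= j < n + N)%N].
Proof.
have /andP[am0 an0] : (a (- m%:Z) != 0) && (a n%:Z != 0).
  by rewrite -negb_or -mulf_eq0.
rewrite mxE; case: ltnP => iN.
  case: (leqP i j) => ij; last first.
    by exists 0, false, false; rewrite !mulr0n !polyC0 !subr0.
  rewrite mulr1n; case: (leqP (j - i) N) => jiN; last first.
    exists 0, false, false; rewrite !mulr0n !polyC0 !subr0; split=> //.
    by rewrite nth_default // size_gpoly.
  rewrite coef_gpoly //.
  exists (a ((j - i)%N%:Z - m%:Z)), (j - i == m)%N, false.
  by rewrite mulr0n subr0 implybT; split=> //; apply/implyP; lia.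
case: (leqP (i - N) j) => ij; last first.
  by exists 0, false, false; rewrite !mulr0n !polyC0 !subr0.
rewrite mulr1n; case: (leqP (j - (i - N)) N) => jiN; last first.
  exists 0, false, false; rewrite !mulr0n !polyC0 !subr0; split=> //.
  by rewrite nth_default // size_gstar.
rewrite coef_gstar //.
exists (conjc (a (n%:Z - (j - (i - N))%N%:Z))), false, (j - (i - N) == n)%N.
rewrite mulr0n subr0 implybT; split=> //; apply/implyP; have := ltn_ord i; lia.
Qed.

Let coef_entry c (b1 b2 : bool) i j :
  (c%:P%:P - 'X *+ b1 - 'Y *+ b2 : {poly {poly C}})`_i`_j != 0 ->
  (i = 0 /\ j = 0 \/ b1 /\ i = 1 /\ j = 0 \/ b2 /\ i = 0 /\ j = 1)%N.
Proof.
have z (b : bool) : (0 : C) *+ b = 0 by rewrite mul0rn.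
case: i => [|[|i]]; case: j => [|[|j]];
  rewrite !(coefB, coefMn, coefC, coefX, coef0) /=
    ?(coefC, coefX, coef0, coef1) /=
    ?mulr0n ?mulr1n ?(coef0, coef1) /= ?z ?subr0 ?eqxx //.
- by left.
- by case: b2; rewrite ?mulr0n ?subr0 ?eqxx // => _; right; right.
- by case: b1; rewrite ?mulr0n ?subr0 ?eqxx // => _; right; left.
Qed.

Let detE : hC m n a = \det M.
Proof. exact: hC_Sylvester. Qed.

Lemma size_hC : (size (hC m n a) <= N.+1)%N.
Proof.
rewrite detE; apply: (@leq_trans (\sum_(i < N + N) (0 <= i < N)%N).+1).
  apply: size_det_rows => i j; have [x [b1 [b2 [-> h1 h2 _]]]] := entry i j.
  by apply/size_leP => k l /coef_entry; lia.
by rewrite sum_interval; lia.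
Qed.

Lemma sizeY_hC : (sizeY (hC m n a) <= N.+1)%N.
Proof.
rewrite detE sizeYE -det_map_mx.
apply: (@leq_trans (\sum_(i < N + N) (N <= i < N + N)%N).+1).
  apply: size_det_rows => i j; have := ltn_ord i.
  have [x [b1 [b2 [E h1 h2 _]]]] := entry i j; rewrite mxE E -sizeYE.
  by move=> iN; apply/sizeY_leP => k l /coef_entry; lia.
by rewrite sum_interval; lia.
Qed.

(** The variables occur to the first power only, and only in the columns of the
    Sylvester matrix from [m] to [n + N - 1]; hence a term of its determinant has
    degree at most [2 n]. *)
Lemma totsize_hC : (totsize (hC m n a) <= n.*2.+1)%N.
Proof.
pose hom : {rmorphism {poly {poly C}} -> {poly {poly C}}} :=
  @swapXY C \o (fun u : {poly {poly C}} => u \Po ('X *: 'X)).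
rewrite detE /totsize -[homogenize _]/(hom _) -det_map_mx.
apply: (@leq_trans (\sum_(j < N + N) (m <= j < n + N)%N).+1).
  apply: size_det_cols => i j; have [x [b1 [b2 [E _ _ h]]]] := entry i j.
  rewrite mxE E -[size _]/(totsize _).
  by apply/totsize_leP => k l /coef_entry; lia.
by rewrite sum_interval; lia.
Qed.

End ResultantDegree.

(** * Zeros of the resultant *)

Section ZeroSet.
Variables (R : realType) (m n : nat) (a : int -> R[i]).
Hypotheses (n0 : (1 <= n)%N) (an : a (- m%:Z) * a n%:Z != 0).
Local Notation C := R[i].

(** On the unit circle [conj z = 1/z], so that [z] is a root of both [g] and
    [g^*] at [(w, conj w)]; their resultant is a combination of them. *)
Lemma hC_laurent z : `|z| = 1 ->
  (hC m n a).[laurent m n a z, conjc (laurent m n a z)] = 0.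
Proof.
move=> z1; set w := laurent m n a z.
have z0 : z != 0 by rewrite -normr_eq0 z1 oner_eq0.
have zconj : conjc z = z^-1.
  apply: (mulfI z0); by rewrite mulfV // -sqr_normc z1 expr1n.
have /andP[am0 an0] : (a (- m%:Z) != 0) && (a n%:Z != 0).
  by rewrite -negb_or -mulf_eq0.
pose ev : {rmorphism {poly {poly C}} -> C} :=
  horner_eval (conjc w) \o horner_eval (w%:P).
pose ev3 : {rmorphism {poly {poly {poly C}}} -> C} :=
  horner_eval z \o map_poly ev.
have ev3C u : ev3 u%:P = ev u by rewrite /= map_polyC /= /horner_eval hornerC.
have ev3g (c : nat -> C) (x : {poly {poly C}}) k :
    ev3 (\poly_(i < (m + n).+1) (c i)%:P%:P - x *: 'X^k) =
    \sum_(i < (m + n).+1) c i * z ^+ i - ev x * z ^+ k.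
  rewrite rmorphB poly_def rmorph_sum; congr (_ - _); last first.
    rewrite -mul_polyC rmorphM ev3C rmorphXn /= map_polyX.
    by rewrite /horner_eval hornerX.
  apply: eq_bigr => i _; rewrite -mul_polyC rmorphM ev3C rmorphXn /= map_polyX.
  by rewrite /horner_eval hornerX !hornerC.
have g0 : ev3 (gpoly m n a) = 0.
  rewrite /gpoly (ev3g (fun i => a (i%:Z - m%:Z))) /= /horner_eval.
  rewrite hornerX hornerC.
  apply/eqP; rewrite subr_eq0; apply/eqP; rewrite /w /laurent mulr_suml.
  apply: eq_bigr => i _; rewrite -mulrA; congr (_ * _).
  by rewrite -[RHS]/(z ^ (i%:Z - m%:Z) * z ^ m%:Z) -expfzDr // subrK.
have gs0 : ev3 (gstar m n a) = 0.
  rewrite /gstar (ev3g (fun i => conjc (a (n%:Z - i%:Z)))) /= /horner_eval.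
  rewrite !hornerC hornerX.
  apply/eqP; rewrite subr_eq0; apply/eqP.
  rewrite /w /laurent rmorph_sum mulr_suml.
  rewrite (reindex_inj rev_ord_inj) /=; apply: eq_bigr => i _.
  have lei : (i <= m + n)%N by rewrite -ltnS.
  rewrite rmorphM -mulrA; congr (conjc (a _) * _); first by lia.
  rewrite fmorphXz /= zconj exprz_inv.
  rewrite -[RHS]/(_ * z ^ n%:Z) -expfzDr // -[LHS]/(z ^ (m + n - i)%N%:Z).
  by congr (z ^ _); lia.
have [|| [U V] _ /= E] := @resultant_in_ideal _ (gpoly m n a) (gstar m n a).
- by rewrite size_gpoly //; lia.
- by rewrite size_gstar //; lia.
have := congr1 ev3 E; rewrite ev3C rmorphD !rmorphM g0 gs0 !mulr0 addr0.
by [].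
Qed.

End ZeroSet.

(** * Passing from real to complex coefficients and variables *)

Section Substitution.
Variable K : comNzRingType.
Implicit Types (s t u v : {poly {poly K}}).

(** [subst2], as a ring morphism in its first argument. *)
Definition subst2_hom s t : {rmorphism {poly {poly K}} -> {poly {poly K}}} :=
  horner_eval t \o (horner_eval s%:P \o map_poly (map_poly (polyC \o polyC))).

Lemma subst2E s t u : subst2 u s t = subst2_hom s t u.
Proof. by []. Qed.

Lemma subst2_X s t : subst2 'X s t = s.
Proof. by rewrite subst2E /= map_polyX /horner_eval hornerX hornerC. Qed.

Lemma subst2_Y s t : subst2 'Y s t = t.
Proof.
by rewrite subst2E /= map_polyC /horner_eval /= hornerC map_polyX hornerX.
Qed.

Lemma subst2_C s t c : subst2 c%:P%:P s t = c%:P%:P.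
Proof.
by rewrite subst2E /= map_polyC /horner_eval /= hornerC map_polyC hornerC.
Qed.

Lemma poly2_hom_ext (f g : {rmorphism {poly {poly K}} -> {poly {poly K}}}) :
  f 'X = g 'X -> f 'Y = g 'Y -> (forall c, f c%:P%:P = g c%:P%:P) -> f =1 g.
Proof.
move=> EX EY EC; elim/poly_ind => [|u p IHu]; first by rewrite !rmorph0.
rewrite !rmorphD !rmorphM /= IHu EX; congr (_ + _).
elim/poly_ind: p => [|q c IHq]; first by rewrite !rmorph0.
by rewrite polyCD polyCM !rmorphD !rmorphM /= IHq EY EC.
Qed.

End Substitution.

Section ChangeOfVariables.
Variables (K : comNzRingType) (iota half : K).
Hypotheses (iota2 : iota * iota = -1) (half2 : half + half = 1).
Implicit Types (u v F G : {poly {poly K}}).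

(* Here [hom_w] substitutes [x = (w + wbar) / 2] and
   [y = - iota (w - wbar) / 2]. *)
Let P2 := {poly {poly K}}.
Let hom_xy := subst2_hom ('X + iota%:P%:P * 'Y) ('X - iota%:P%:P * 'Y).
Let hom_w := subst2_hom (half%:P%:P * ('X + 'Y))
  (- (iota%:P%:P * half%:P%:P) * ('X - 'Y)).

Lemma subst_xyK : cancel hom_xy hom_w.
Proof.
have gX : hom_w 'X = half%:P%:P * ('X + 'Y) by exact: subst2_X.
have gY : hom_w 'Y = - (iota%:P%:P * half%:P%:P) * ('X - 'Y) by exact: subst2_Y.
have gC c : hom_w c%:P%:P = c%:P%:P by exact: subst2_C.
have fX : hom_xy 'X = 'X + iota%:P%:P * 'Y by exact: subst2_X.
have fY : hom_xy 'Y = 'X - iota%:P%:P * 'Y by exact: subst2_Y.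
have fC c : hom_xy c%:P%:P = c%:P%:P by exact: subst2_C.
move: hom_w hom_xy gX gY gC fX fY fC => g f gX gY gC fX fY fC.
have h2 : half%:P%:P + half%:P%:P = 1 :> P2 by rewrite -!polyCD half2.
have hY : iota%:P%:P * (- (iota%:P%:P * half%:P%:P) * ('X - 'Y)) =
    half%:P%:P * ('X - 'Y) :> P2.
  by rewrite mulrA mulrN mulrA -!polyCM iota2 mulN1r !polyCN opprK.
pose gf : {rmorphism P2 -> P2} := g \o f.
apply: (@poly2_hom_ext _ gf idfun) => [||c] /=.
- rewrite fX rmorphD rmorphM /= gX gC gY hY.
  by rewrite -mulrDr addrACA subrr addr0 mulrDr -mulrDl h2 mul1r.
- rewrite fY rmorphB rmorphM /= gX gC gY hY.
  rewrite -mulrBr opprB (addrC 'X) addrACA subrr addr0.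
  by rewrite mulrDr -mulrDl h2 mul1r.
- by rewrite fC gC.
Qed.

(** The absence of nontrivial syzygies is preserved by the linear change of
    variables [w = x + iota y], [wbar = x - iota y]. *)
Lemma syzygy_subst_xy F G (h := fun u => subst2 u
    ('X + iota%:P%:P * 'Y) ('X - iota%:P%:P * 'Y)) :
  (forall A B, h F * A = h G * B -> exists C, A = h G * C) ->
  forall A B, F * A = G * B -> exists C, A = G * C.
Proof.
move=> syz A B /(congr1 hom_xy); rewrite !rmorphM => /syz[D ED].
by exists (hom_w D); rewrite -[A]subst_xyK [X in hom_w X]ED rmorphM subst_xyK.
Qed.

Lemma subst_xy_const F c :
  subst2 F ('X + iota%:P%:P * 'Y) ('X - iota%:P%:P * 'Y) = c%:P%:P ->
  F = c%:P%:P.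
Proof.
by move=> E; rewrite -[F]subst_xyK [hom_xy F]E; exact: subst2_C.
Qed.

End ChangeOfVariables.

Section Complexification.
Variable R : realType.
Local Notation C := R[i].
Local Notation cplx u := (map_poly (map_poly (real_complex R)) u).

Lemma coef_map_part (f : C -> R) (A : {poly {poly C}}) i j :
  f 0 = 0 -> (map_poly (map_poly f) A)`_i`_j = f A`_i`_j.
Proof.
by move=> f0; rewrite coef_map_id0 ?map_poly0 // coef_map_id0.
Qed.

(** To be used with the real and the imaginary part, which are linear over the
    real numbers. *)
Lemma real_part_mul (f : C -> R) (F : {poly {poly R}}) (A : {poly {poly C}}) :
    f 0 = 0 -> {morph f : x y / x + y} ->
    (forall (r : R) z, f (real_complex R r * z) = r * f z) ->
  map_poly (map_poly f) (cplx F * A) = F * map_poly (map_poly f) A.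
Proof.
move=> f0 fD fM; apply/polyP => i; apply/polyP => j.
rewrite coef_map_part // !coefM !coef_sum.
rewrite (big_morph f fD f0); apply: eq_bigr => k _.
rewrite !coefM (big_morph f fD f0); apply: eq_bigr => l _.
by rewrite !coef_map /= fM coef_map_part.
Qed.

(** The absence of nontrivial syzygies is preserved by extension of the scalars
    from the real to the complex numbers. *)
Lemma syzygy_complex (F G : {poly {poly R}}) :
  (forall A B, F * A = G * B -> exists C, A = G * C) ->
  forall A B, cplx F * A = cplx G * B -> exists C, A = cplx G * C.
Proof.
move=> syz A B AB.
pose re := map_poly (map_poly (@complex.Re R)).
pose im := map_poly (map_poly (@complex.Im R)).
have reM H D : re (cplx H * D) = H * re D.
  apply: real_part_mul => //; first by case=> ? ? [].
  by move=> r [x y] /=; rewrite mul0r subr0.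
have imM H D : im (cplx H * D) = H * im D.
  apply: real_part_mul => //; first by case=> ? ? [].
  by move=> r [x y] /=; rewrite mul0r addr0.
have [C1 E1] : exists D, re A = G * D.
  by apply: (syz _ (re B)); rewrite -!reM AB.
have [C2 E2] : exists D, im A = G * D.
  by apply: (syz _ (im B)); rewrite -!imM AB.
exists (cplx C1 + 'i%C%:P%:P * cplx C2).
rewrite mulrDr mulrCA -!rmorphM -E1 -E2.
apply/polyP => i; apply/polyP => j.
rewrite !coefD !coefCM !coef_map /=.
exact: complexE.
Qed.

End Complexification.

(** * Counting the points of intersection *)

Local Open Scope classical_set_scope.
Local Open Scope card_scope.

Lemma card_le_II_seq (T : choiceType) (A : set T) N :
  (forall s : seq T, uniq s -> (forall x, x \in s -> A x) -> (size s <= N)%N) ->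
  A #<= `I_N.
Proof.
move=> H; case: (pselect (finite_set A)) => [finA|].
  have /finite_setP[k Ak] := finA.
  rewrite (card_le_eql Ak) card_le_II -(card_fset_set Ak); apply: H => [|x].
    exact: finmap.fset_uniq.
  by rewrite in_fset_set // inE.
move=> /(@infinite_set_fset _ _ N.+1)[B BA].
by rewrite ltnNge H ?finmap.fset_uniq // => x xB; apply: BA.
Qed.

Lemma common_factor_sym (K : comNzRingType) (F G : {poly {poly K}}) :
  have_nonconstant_common_factor F G -> have_nonconstant_common_factor G F.
Proof. by case=> f [? ? ?]; exists f; split. Qed.

(** A polynomial [F] which has no nonconstant common factor with [G] can only
    vanish if [G] is a nonzero constant. *)
Lemma no_common_factor_neq0 (K : comNzRingType) (F G : {poly {poly K}}) :
  ~ have_nonconstant_common_factor F G -> (forall c, G = c%:P%:P -> c = 0) ->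
  F != 0.
Proof.
move=> nFG Gc; apply/eqP => F0; apply: nFG.
case: (pselect (exists c, G = c%:P%:P)) => [[c Ec]|nc].
  exists 'X; rewrite F0 Ec (Gc c Ec) !polyC0.
  split; try by exists 0; rewrite mulr0.
  move=> c' /(congr1 (fun p : {poly {poly K}} => size p)).
  rewrite size_polyX => E.
  by have := size_polyC_leq1 (c'%:P); rewrite -E.
exists G; split; first by move=> c Ec; apply: nc; exists c.
- by exists 0; rewrite F0 mulr0.
- by exists 1; rewrite mulr1.
Qed.

Lemma hC_const (R : realType) (m n : nat) (a : int -> R[i]) c :
  (1 <= n)%N -> a (- m%:Z) * a n%:Z != 0 -> hpoly m n a = c%:P%:P ->
  hC m n a = (real_complex R c)%:P%:P.
Proof.
move=> n0 an Ec; apply: (@subst_xy_const _ 'i%C 2^-1).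
- by rewrite -expr2 sqr_i.
- by rewrite -mulr2n -[_ *+ 2]mulr_natr mulVf ?pnatr_eq0.
- by rewrite -[LHS]/(hsub m n a) -hpolyE // Ec !map_polyC /= map_polyC.
Qed.

Theorem theorem5p1 (R : realType) (m n r s : nat) (a b : int -> R[i])
  (hn : (1 <= n)%N) (hs : (1 <= s)%N) (hmn : (m <= n)%N) (hrs : (r <= s)%N)
  (hab : a (- m%:Z) * a n%:Z * b (- r%:Z) * b s%:Z != 0) :
  ~ have_nonconstant_common_factor (hpoly m n a) (hpoly r s b) ->
  (laurent m n a @` @unit_circle R) `&` (laurent r s b @` @unit_circle R)
    #<= `I_(4 * n * s - 2 * (n - m) * (s - r))%N.
Proof.
move=> nFG.
have [an bn] : a (- m%:Z) * a n%:Z != 0 /\ b (- r%:Z) * b s%:Z != 0.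
  by apply/andP; rewrite -negb_or -mulf_eq0 mulrA.
apply: card_le_II_seq => ws us ws_in.
have zeros w : w \in ws ->
    (hC m n a).[w, conjc w] = 0 /\ (hC r s b).[w, conjc w] = 0.
  by move=> /ws_in[[z z1 <-] [z' z'1 E]]; rewrite -{3 4}E !hC_laurent.
case: (posnP (size ws)) => [-> //|].
rewrite -has_predT => /hasP[w0 /zeros[wa wb] _].
have constE (k l : nat) (c : int -> R[i]) : (1 <= l)%N ->
    c (- k%:Z) * c l%:Z != 0 -> (hC k l c).[w0, conjc w0] = 0 ->
    forall x, hpoly k l c = x%:P%:P -> x = 0.
  move=> l0 cl w0c x /hC_const Ex; rewrite Ex // !hornerC in w0c.
  by case: w0c.
have Fa0 : hpoly m n a != 0.
  by apply: no_common_factor_neq0 nFG _; apply: constE.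
have Fb0 : hpoly r s b != 0.
  apply: (@no_common_factor_neq0 _ _ (hpoly m n a)); last exact: constE.
  by move/common_factor_sym.
have hC0 k l (c : int -> R[i]) : hpoly k l c != 0 -> hC k l c != 0.
  apply: contraNneq => E; rewrite /hpoly /hsub E subst2E rmorph0.
  by rewrite map_poly0.
have syz : forall A B, hC m n a * A = hC r s b * B ->
    exists C, A = hC r s b * C.
  apply: (@syzygy_subst_xy _ 'i%C 2^-1).
  - by rewrite -expr2 sqr_i.
  - by rewrite -mulr2n -[_ *+ 2]mulr_natr mulVf ?pnatr_eq0.
  - rewrite -/(hsub m n a) -/(hsub r s b) -!hpolyE //.
    exact: (syzygy_complex (coprime_syzygy Fa0 Fb0 nFG)).
have : (size [seq (w, conjc w) | w <- ws] <=
  (n.*2 - (m + n)) * (r + s).*2 + ((m + n).*2 - n.*2) * s.*2)%N.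
  apply: (bezout_bound (hC0 _ _ _ Fa0) (hC0 _ _ _ Fb0) syz).
  - lia.
  - exact: size_hC.
  - exact: sizeY_hC.
  - exact: totsize_hC.
  - exact: size_hC.
  - exact: sizeY_hC.
  - exact: totsize_hC.
  - by rewrite map_inj_uniq // => x y [].
  - by move=> x /mapP[w /zeros ? ->].
rewrite size_map => /leq_trans; apply.
have [e ->] : exists e, n = (m + e)%N by exists (n - m)%N; lia.
have [f ->] : exists f, s = (r + f)%N by exists (s - r)%N; lia.
have -> : (m + e - m = e)%N by lia.
have -> : (r + f - r = f)%N by lia.
have -> : ((m + e).*2 - (m + (m + e)) = e)%N by lia.
have -> : ((m + (m + e)).*2 - (m + e).*2 = m.*2)%N by lia.
by rewrite -!muln2 !(mulnDl, mulnDr); nia.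
Qed.
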